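(* Let $n,\ell,d$ be integers with $4\leq d\leq n-1$ and $2\leq \ell\leq n-1$. Then $$e_3(n,\ell,d)\leq \frac{(n-d+1)(n-d+2)}{2}+d-3.$$
   Context: All graphs are undirected, finite and simple. For a graph $G$ and a nonempty set $S\subseteq V(G)$, the Steiner distance $d_G(S)$ is the minimum number of edges of a connected subgraph (equivalently, a subtree) of $G$ whose vertex set contains $S$; set $d_G(S)=\infty$ if there is none. The Steiner $3$-diameter is $sdiam_3(G)=\max\{d_G(S): S\subseteq V(G),\ |S|=3\}$. For natural numbers $n,\ell,d$ with $d<n$, $\ell<n$, let $\mathscr{H}_3(n,\ell,d)$ be the set of all graphs $G$ of order $n$ with maximum degree exactly $\ell$ and $sdiam_3(G)\leq d$. Put $e_3(n,\ell,d)=\min\{|E(G)|: G\in \mathscr{H}_3(n,\ell,d)\}$, with $e_3(n,\ell,d)=\infty$ if $\mathscr{H}_3(n,\ell,d)=\emptyset$.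
   Formalization: The formal theorem additionally assumes that the class H_3(n,l,d) is nonempty (e_3 finite); without this the claim fails, e.g. n=10, l=2, d=4, where only P_10 and C_10 are connected and both have sdiam_3 > 4, so e_3 is infinite. *)

(* Defs.v *)
From HB Require Import structures.
From mathcomp Require Import all_boot all_order all_algebra.
From mathcomp Require Import constructive_ereal.

Set Implicit Arguments.
Unset Strict Implicit.
Unset Printing Implicit Defensive.

Import Order.TTheory GRing.Theory Num.Theory.

(* A graph with vertex type V is given by its set of edges, an edge being the
   two-element set of its ends. *)
Definition simple_graph (V : finType) (E : {set {set V}}) : bool :=
  [forall e in E, #|e| == 2].

Definition adj (V : finType) (E : {set {set V}}) : rel V :=
  fun x y => [set x; y] \in E.

Definition degree (V : finType) (E : {set {set V}}) (x : V) : nat :=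
  #|[set y | adj E x y]|.

Definition max_degree (V : finType) (E : {set {set V}}) : nat :=
  \max_(x : V) degree E x.

(* H = (W, F) has vertex set W and edge set F. *)
Definition subgraph (V : finType) (E : {set {set V}})
    (H : {set V} * {set {set V}}) : bool :=
  (H.2 \subset E) && [forall e in H.2, e \subset H.1].

Definition connected_graph (V : finType) (H : {set V} * {set {set V}}) : bool :=
  (H.1 != set0) && [forall x in H.1, forall y in H.1, connect (adj H.2) x y].

(* The values are natural numbers or +oo, embedded in \bar int; a minimum over
   the empty family is +oo. *)
Definition steiner_distance (V : finType) (E : {set {set V}}) (S : {set V}) :
    \bar int :=
  \big[Order.min/+oo%E]_(H : {set V} * {set {set V}} |
      [&& subgraph E H, connected_graph H & S \subset H.1])
    (#|H.2|%:Z)%:E.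

(* 0 is only the neutral element for max of nonnegative values: it matters
   only when V has fewer than three elements. *)
Definition sdiam3 (V : finType) (E : {set {set V}}) : \bar int :=
  \big[Order.max/0%:E]_(S : {set V} | #|S| == 3) steiner_distance E S.

(* The graphs of order n are represented on the vertex set 'I_n. *)
Definition H3 (n l d : nat) : {set {set {set 'I_n}}} :=
  [set E : {set {set 'I_n}} | [&& simple_graph E, max_degree E == l
                                & (sdiam3 E <= (d%:Z)%:E)%E]].

Definition e3 (n l d : nat) : \bar int :=
  \big[Order.min/+oo%E]_(E in H3 n l d) (#|E|%:Z)%:E.

(* Main.v *)
(* Write k = n - d.  If k <= (d-2)(l-2), there is a caterpillar of maximum
   degree l with at most d - 2 spine vertices: three vertices together with the
   spine span a subtree with at most d edges, and the caterpillar has only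
   n - 1 edges.  If k = 1, a path (l = 2) works since every subtree has at most
   n - 1 = d edges.  Otherwise l is so small that the trivial bound n l / 2 on
   the number of edges of any member of H3 n l d is below the claimed one. *)

Require Import Defs.
From mathcomp Require Import all_boot all_order all_algebra.
From mathcomp Require Import constructive_ereal.
From mathcomp Require Import zify.

Set Implicit Arguments.
Unset Strict Implicit.
Unset Printing Implicit Defensive.

(** * Bounding [e3] by one member, and edges by degrees *)

Lemma le_fin_nat (a b : nat) : a <= b -> ((a%:Z)%:E <= (b%:Z)%:E)%E.
Proof. by rewrite lee_fin lez_nat. Qed.

Lemma e3_le (n l d : nat) (E : {set {set 'I_n}}) (m : nat) :
  E \in H3 n l d -> #|E| <= m -> (e3 n l d <= (m%:Z)%:E)%E.
Proof.
move=> EH le_m; apply: Order.le_trans (le_fin_nat le_m).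
exact: (Order.TotalTheory.bigmin_le_cond _
  (fun F : {set {set 'I_n}} => (#|F|%:Z)%:E%E)).
Qed.

Lemma degree_le_max (V : finType) (E : {set {set V}}) (x : V) :
  degree E x <= max_degree E.
Proof. exact: (@leq_bigmax _ (degree E) x). Qed.

(** Double counting of incidences: the edges at x are images of its neighbours y under y -> {x,
    y}. *)
Lemma card_edges_le (V : finType) (E : {set {set V}}) :
  simple_graph E -> #|E|.*2 <= #|V| * max_degree E.
Proof.
move=> /forall_inP E2.
have -> : #|E|.*2 = \sum_(e in E) #|e|.
  rewrite (eq_bigr (fun=> 2)) => [|e /E2/eqP //].
  by rewrite sum_nat_const muln2.
under eq_bigr => e _ do rewrite -sum1_card.
rewrite (exchange_big_dep xpredT) //= -sum_nat_const.
apply: leq_sum => x _; apply: leq_trans (degree_le_max E x).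
rewrite sum1dep_card /degree.
apply: leq_trans (leq_imset_card (fun y => [set x; y]) _).
apply/subset_leq_card/subsetP => e; rewrite inE => /andP[eE xe].
have /cards2P[a [b [_ eab]]] := E2 _ eE.
have nbr y : e = [set x; y] -> e \in [set [set x; z] | z in [set z | adj E x z]].
  by move=> exy; apply/imsetP; exists y; rewrite // inE /adj -exy.
move: xe; rewrite eab !inE -eab => /orP[] /eqP xE; last rewrite setUC in eab.
  by apply: (nbr b); rewrite xE.
by apply: (nbr a); rewrite xE.
Qed.

(** * Trees given by a parent map *)

Definition parent_edges (V : finType) (p : V -> V) (r : V) (W : {set V}) :
    {set {set V}} :=
  [set [set x; p x] | x in W :\ r].

Lemma adj_sym (V : finType) (E : {set {set V}}) : symmetric (adj E).
Proof. by move=> x y; rewrite /adj setUC. Qed.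

Section RootedTree.

Variables (V : finType) (p : V -> V) (r : V) (h : V -> nat).
(** A height that drops along [p] rules out loops and makes iterated parents end at [r]. *)
Hypothesis hp : forall x, x != r -> h (p x) < h x.

Lemma simple_parent_edges (W : {set V}) : simple_graph (parent_edges p r W).
Proof.
apply/forall_inP => e /imsetP[x]; rewrite !inE => /andP[xr _] ->.
rewrite cards2; case: (eqVneq x (p x)) => // xp.
by have := hp xr; rewrite -xp ltnn.
Qed.

Lemma card_parent_edges (W : {set V}) :
  r \in W -> #|parent_edges p r W| <= #|W|.-1.
Proof.
move=> rW; apply: leq_trans (leq_imset_card _ _) _.
by rewrite (cardsD1 r W) rW.
Qed.

Lemma connected_parent_edges (W : {set V}) :
  r \in W -> (forall x, x \in W -> x != r -> p x \in W) ->
  connected_graph (W, parent_edges p r W).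
Proof.
move=> rW pW; rewrite /connected_graph /=.
apply/andP; split; first by apply/set0Pn; exists r.
have symc : connect_sym (adj (parent_edges p r W)).
  exact/sym_connect_sym/adj_sym.
have cr x : x \in W -> connect (adj (parent_edges p r W)) x r.
  have [m] := ubnP (h x); elim: m x => // m IHm x hx xW.
  have [-> // | xr] := eqVneq x r.
  apply: (@connect_trans _ _ (p x)).
    by apply/connect1/imsetP; exists x; rewrite // !inE xr.
  by apply: IHm (pW x xW xr); apply: leq_trans (hp xr) _.
apply/forall_inP => x xW; apply/forall_inP => y yW.
by apply: connect_trans (cr x xW) _; rewrite symc cr.
Qed.

(** A parent-closed W containing the root carries a subtree of the whole tree, which competes in the
    minimum. *)
Lemma steiner_parent_edges (S W : {set V}) :
  r \in W -> (forall x, x \in W -> x != r -> p x \in W) -> S \subset W ->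
  (steiner_distance (parent_edges p r setT) S <= (#|W|.-1%:Z)%:E)%E.
Proof.
move=> rW pW SW.
apply: Order.le_trans (le_fin_nat (card_parent_edges rW)).
apply: (Order.TotalTheory.bigmin_le_cond _ (j := (W, parent_edges p r W))
  (fun H : {set V} * {set {set V}} => (#|H.2|%:Z)%:E%E)).
rewrite connected_parent_edges // SW andbT andbT; apply/andP; split.
  by apply/imsetS/setSD/subsetT.
apply/forall_inP => e /imsetP[x]; rewrite !inE => /andP[xr xW] ->.
by apply/subsetP => y; rewrite !inE => /orP[] /eqP -> //; apply: pW.
Qed.

End RootedTree.

(* The spine is 0, ..., s-1; the leaves s and s+1 hang from its two ends, and
   the remaining ones are attached in consecutive blocks of l - 2, the last
   block possibly incomplete.  Truncated subtraction gives s+1 the parent 0. *)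
Definition cat_parent (l s i : nat) : nat :=
  if i <= s then i.-1 else (i - s - 2) %/ (l - 2).

(** * Degrees and Steiner diameter of the caterpillar *)

Section Caterpillar.

Variables (n l s : nat).
Hypotheses (s_gt0 : 0 < s) (l_ge2 : 2 <= l).
(** There are n + 1 - s leaves: [l_le] supplies enough of them to give vertex 0 degree l, and
    [le_cap] lets them fit, l - 2 per spine vertex and one more at each end. *)
Hypotheses (l_le : l <= n.+1 - s) (le_cap : n.+1 - s <= (l - 2) * s + 2).

Let p (x : 'I_n.+1) : 'I_n.+1 := inord (cat_parent l s x).
Let E := parent_edges p ord0 setT.

Lemma cat_parent_lt_spine (i : nat) : i < n.+1 -> cat_parent l s i < s.
Proof.
move=> i_n; rewrite /cat_parent; case: (leqP i s) => i_s; first by lia.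
(* If l = 2, then s + 1 is the only vertex beyond s, and division by 0 gives it the intended parent
   0. *)
have [-> | l2] := posnP (l - 2); first by rewrite divn0.
rewrite ltn_divLR // (mulnC s); lia.
Qed.

Lemma cat_parent_lt (i : nat) : 0 < i -> cat_parent l s i < i.
Proof.
move=> i0; rewrite /cat_parent; case: (leqP i s) => i_s; first by lia.
by apply: leq_ltn_trans (leq_div _ _) _; lia.
Qed.

Lemma val_parent (x : 'I_n.+1) : p x = cat_parent l s x :> nat.
Proof.
by rewrite inordK //; have := cat_parent_lt_spine (ltn_ord x); lia.
Qed.

Lemma parent_lt (x : 'I_n.+1) : x != ord0 -> p x < x.
Proof.
by move=> x0; rewrite val_parent cat_parent_lt // lt0n.
Qed.

Lemma adj_caterpillar (x y : 'I_n.+1) :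
  adj E x y = (0 < x) && (y == cat_parent l s x :> nat)
           || (0 < y) && (x == cat_parent l s y :> nat).
Proof.
apply/imsetP/orP => [[z]|].
  rewrite !inE andbT => z0 exy.
  have zp : z != p z by apply: contraTneq (parent_lt z0) => <-; rewrite ltnn.
  have xy : x != y.
    by have := cards2 x y; rewrite exy cards2 zp; case: eqVneq.
  have: x \in [set z; p z] by rewrite -exy !inE eqxx.
  have: y \in [set z; p z] by rewrite -exy !inE eqxx orbT.
  rewrite !inE => /orP[] /eqP yE /orP[] /eqP xE; move: xy;
    rewrite ?xE ?yE ?eqxx // => _.
    by right; rewrite val_parent lt0n z0 /=.
  by left; rewrite val_parent lt0n z0 /=.
case=> /andP[z0 /eqP zE].
  exists x; first by rewrite !inE andbT -lt0n.
  by congr [set _; _]; apply: val_inj; rewrite /= val_parent.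
exists y; first by rewrite !inE andbT -lt0n.
by rewrite setUC; congr [set _; _]; apply: val_inj; rewrite /= val_parent.
Qed.

Lemma degree_caterpillar_le (x : 'I_n.+1) : degree E x <= l.
Proof.
rewrite /degree.
(* [a] is the parent, or for the root its end leaf s + 1; [b] holds the next vertex (the leaf s when
   x = s - 1) and the block of leaves of x. *)
pose a := if x == 0 :> nat then s.+1 else cat_parent l s x.
pose b := if x < s then [:: x.+1 & iota (s + 2 + x * (l - 2)) (l - 2)] else [::].
have -> : #|[set y | adj E x y]| = size (map val (enum [set y | adj E x y])).
  by rewrite size_map -cardE.
apply: (@leq_trans (size (a :: b))); last first.
  by rewrite /b; case: ifP => _ /=; rewrite ?size_iota; lia.
apply: uniq_leq_size => [|_ /mapP[y + ->]].
  by rewrite map_inj_uniq ?enum_uniq //; apply: val_inj.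
rewrite mem_enum inE adj_caterpillar inE => /orP[/andP[x0 /eqP yE]|].
  by rewrite /a (gtn_eqF x0) /= yE eqxx.
case/andP=> y0 /eqP xE; have y_n := ltn_ord y.
have xs : x < s by rewrite xE cat_parent_lt_spine.
rewrite /b xs inE mem_iota /=.
move: xE; rewrite /cat_parent; case: (leqP y s) => ys xE.
  by apply/or3P/Or32; lia.
have [yE|y2] := eqVneq (y : nat) s.+1.
  have ys0 : y - s - 2 = 0 by lia.
  by rewrite /a xE ys0 div0n /= yE eqxx.
apply/or3P/Or33.
have l2 : 0 < l - 2.
  by rewrite lt0n; apply/eqP => l0; move: le_cap; rewrite l0; lia.
have := divn_eq (y - s - 2) (l - 2); rewrite -xE.
have := ltn_pmod (y - s - 2) l2; lia.
Qed.

Lemma degree_caterpillar_ge : l <= degree E ord0.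
Proof.
(* The vertex 1 (a leaf if s = 1), the end leaf s + 1 and a full block of l - 2 leaves, all present
   by [l_le]. *)
pose b := 1 :: iota s.+1 (l - 1).
have lb : l = size b by rewrite /= size_iota; lia.
rewrite lb /degree.
have -> : #|[set y | adj E ord0 y]| = size (map val (enum [set y | adj E ord0 y])).
  by rewrite size_map -cardE.
apply: uniq_leq_size; first by rewrite /= iota_uniq mem_iota; lia.
move=> i ib.
have i_n : i < n.+1 by move: ib; rewrite inE mem_iota; lia.
apply/mapP; exists (Ordinal i_n) => //.
rewrite mem_enum inE adj_caterpillar /=.
move: ib; rewrite /cat_parent inE mem_iota => /orP[/eqP ->|/andP[si il]].
  by rewrite s_gt0.
rewrite (leqNgt i s) si /= (leq_trans _ si) //=.
have [l0 | l2] := posnP (l - 2); first by rewrite l0 divn0.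
by rewrite divn_small //; lia.
Qed.

Lemma max_degree_caterpillar : max_degree E = l.
Proof.
apply/eqP; rewrite eqn_leq (leq_trans degree_caterpillar_ge) ?degree_le_max //.
by rewrite andbT; apply/bigmax_leqP => x _; apply: degree_caterpillar_le.
Qed.

Lemma sdiam3_caterpillar (d : nat) :
  minn (s + 2) n <= d -> (sdiam3 E <= (d%:Z)%:E)%E.
Proof.
move=> sd; apply: Order.POrderTheory.bigmax_le; first exact: (@le_fin_nat 0).
(* All parents lie on the spine, so adding the spine to S gives a parent-closed set. *)
move=> S /eqP S3; pose W := [set x : 'I_n.+1 | x < s] :|: S.
have := @steiner_parent_edges _ p ord0 val parent_lt S W.
move=> /(_ _ _ _)/Order.le_trans; apply.
- by rewrite !inE s_gt0.
- by move=> x _ _; rewrite !inE val_parent cat_parent_lt_spine.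
- exact: subsetUr.
apply: le_fin_nat; apply: leq_trans sd.
have Ws : #|W| <= s + 3.
  rewrite -S3; apply: leq_trans (leq_card_setU _ _) _; rewrite leq_add2r.
  rewrite cardE -(size_map val) -[leqRHS](size_iota 0); apply: uniq_leq_size.
    by rewrite map_inj_uniq ?enum_uniq //; apply: val_inj.
  by move=> _ /mapP[x + ->]; rewrite mem_enum inE mem_iota.
have Wn : #|W| <= n.+1 by rewrite -[leqRHS]card_ord max_card.
rewrite leq_min; lia.
Qed.

Lemma e3_caterpillar (d : nat) :
  minn (s + 2) n <= d -> (e3 n.+1 l d <= (n%:Z)%:E)%E.
Proof.
move=> sd; apply: (@e3_le _ _ _ E).
  rewrite inE max_degree_caterpillar eqxx sdiam3_caterpillar // !andbT.
  exact: simple_parent_edges parent_lt _.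
apply: leq_trans (card_parent_edges _ (in_setT _)) _.
by rewrite cardsT card_ord.
Qed.

End Caterpillar.

(** * Arithmetic and choice of the spine length *)

Lemma double_half_bound (n d : nat) : 4 <= d -> d <= n - 1 ->
  (((n - d + 1) * (n - d + 2)) %/ 2 + d - 3).*2
    = (n - d + 1) * (n - d + 2) + (d - 3).*2.
Proof.
(* The factors are consecutive, so the division by 2 is exact. *)
move=> d4 dn; have : ~~ odd ((n - d + 1) * (n - d + 2)).
  by rewrite addn2 addn1 oddM /=; case: (odd _).
rewrite divn2 => /even_halfK; set a := (_ * _); lia.
Qed.

(** With k = n - d and u = l - 2, this compares n l with twice the claimed bound. As d u <= k - 1 +
    2 u, the left side is at most (k + 2) u + 3 k - 1 + 2 d; then 2 u <= k - 1 suffices for k >= 3,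
    while k = 2 forces u = 0. *)
Lemma degree_bound_le (k d u : nat) : 4 <= d -> 2 <= k -> u * (d - 2) < k ->
  (k + d) * (u + 2) <= (k + 1) * (k + 2) + (d - 3).*2.
Proof.
move=> d4 k2 ud.
have [k3|] := leqP 3 k; last first.
  move=> k_lt3; have -> : u = 0 by nia.
  nia.
have u2 : u * 2 <= k - 1 by nia.
have : (k + 2) * (u * 2) <= (k + 2) * (k - 1) by rewrite leq_mul2l u2 orbT.
nia.
Qed.

Theorem proposition5p1 (n l d : nat)
    (hd4 : (4 <= d)%N) (hdn : (d <= n - 1)%N)
    (hl2 : (2 <= l)%N) (hln : (l <= n - 1)%N)
    (hne : H3 n l d != set0) :
  (e3 n l d <=
    ((((n - d + 1) * (n - d + 2)) %/ 2 + d - 3)%N%:Z)%:E)%E.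
Proof.
have B2 := double_half_bound hd4 hdn.
set B := _ %/ 2 + d - 3 in B2 *.
have nB : n.-1 <= B by rewrite -leq_double B2; nia.
have nE : n = n.-1.+1 by lia.
have tree s : 0 < s -> l <= n - s -> n - s <= (l - 2) * s + 2 ->
    minn (s + 2) n.-1 <= d -> (e3 n l d <= (B%:Z)%:E)%E.
  clear -nB nE hl2; rewrite {1 2 4}nE => s0 ls cap sd.
  apply: Order.le_trans (le_fin_nat nB).
  exact: (@e3_caterpillar _ _ s).
have [kc | ck] := leqP (n - d) ((l - 2) * (d - 2)).
  (* s = d - 2 is the longest spine with s + 2 <= d. If it leaves fewer than l leaves, s = n - l
     leaves exactly l, and they fit because n - l >= 1. *)
  have [le_s | lt_s] := leqP (d - 2) (n - l); first by apply: (tree (d - 2)); lia.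
  by apply: (tree (n - l)); nia.
(* Here [ck] forces l = 2; n - 2 spine vertices give the path, whose Steiner diameter is covered by
   the second term of [minn]. *)
have [k1 | k2] := leqP (n - d) 1; first by apply: (tree (n - 2)); nia.
(* Any member serves, since only its maximum degree enters the count. *)
have /set0Pn[E EH] := hne; apply: e3_le (EH) _.
move: EH; rewrite inE => /and3P[/card_edges_le + /eqP lE _].
rewrite lE card_ord -(leq_double _ B) B2 => /leq_trans; apply.
have := degree_bound_le hd4 k2 ck.
by rewrite !subnK //; lia.
Qed.
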